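(* Let $n\ge2$ and $1\le i\le\binom n2$, and let $\mathscr{M}^q_{n,i}=(a_{\alpha,\beta})_{\alpha,\beta\in\mathfrak{S}_n}$ be the matrix of left multiplication by $\mathscr{Y}_{n,i}$ on $H_n(q)$ with respect to the standard basis. Then $\mathscr{M}^q_{n,i}$ is $q$-symmetric, that is, $$q^{\ell(\alpha)}a_{\alpha,\beta}=q^{\ell(\beta)}a_{\beta,\alpha}\qquad\text{for all }\alpha,\beta\in\mathfrak{S}_n.$$ In particular, the matrix $\mathscr{M}_{n,i}$ of left multiplication by $\sum_{w\in\mathfrak{S}_n,\ \ell(w)=i}w$ on the group algebra $\mathbb{C}\mathfrak{S}_n$, with respect to the basis $\mathfrak{S}_n$, is symmetric.
   Context: Let $q$ be an indeterminate. $H_n(q)$ is the unital associative $\mathbb{C}(q)$-algebra generated by $T_1,\dots,T_{n-1}$ with relations $T_i^2=(q-1)T_i+q$ for $1\le i\le n-1$, $T_iT_j=T_jT_i$ for $|i-j|\ge2$, and $T_iT_{i+1}T_i=T_{i+1}T_iT_{i+1}$ for $1\le i\le n-2$. Let $\mathfrak{S}_n$ be the symmetric group with simple transpositions $s_i=(i,i+1)$ and Coxeter length $\ell$. For $w\in\mathfrak{S}_n$ with reduced expression $w=s_{i_1}\cdots s_{i_k}$ put $T_w=T_{i_1}\cdots T_{i_k}$ (with $T_e=1$); this is independent of the reduced expression and $\{T_w : w\in\mathfrak{S}_n\}$ is a $\mathbb{C}(q)$-basis of $H_n(q)$, called the standard basis. For $0\le k\le\binom n2$ put $\mathscr{Y}_{n,k}=\sum_{w\in\mathfrak{S}_n,\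 \ell(w)=k}T_w$. The entries of the matrix of left multiplication are determined by $\mathscr{Y}_{n,i}T_\beta=\sum_{\alpha\in\mathfrak{S}_n}a_{\alpha,\beta}T_\alpha$ for $\beta\in\mathfrak{S}_n$; similarly for $\mathscr{M}_{n,i}$ with the basis $\mathfrak{S}_n$ of $\mathbb{C}\mathfrak{S}_n$. Rows and columns are both ordered by one fixed total order on $\mathfrak{S}_n$ (in the paper, the length-plus-lexicographic order: by length, then lexicographically by reduced words with $s_1<s_2<\cdots<s_{n-1}$); the statement does not depend on the choice of this order. *)

(* Defs.v *)
From HB Require Import structures.
From mathcomp Require Import all_boot all_order all_fingroup all_algebra.
From mathcomp Require Import mxrepresentation generic_quotient ring_quotient fraction.
From mathcomp Require Import finmap boolp reals complex monalg.

Set Implicit Arguments.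
Unset Strict Implicit.
Unset Printing Implicit Defensive.

Import GRing.Theory.
Local Open Scope ring_scope.

(* Indices are shifted by one: i : 'I_n.-1 stands for the generator i+1. *)
Section Coxeter.
Variable n : nat.

Fact ltn_simple_l (i : 'I_n.-1) : (i < n)%N.
Proof. by rewrite (leq_trans (ltn_ord i)) ?leq_pred. Qed.

Fact ltn_simple_r (i : 'I_n.-1) : (i.+1 < n)%N.
Proof. by rewrite -ltn_predRL. Qed.

Definition simple_transp (i : 'I_n.-1) : 'S_n :=
  tperm (Ordinal (ltn_simple_l i)) (Ordinal (ltn_simple_r i)).

(* Permutations compose left to right in MathComp. Exchanging the two
   conventions amounts to w |-> w^-1, which fixes each simple transposition. *)
Definition word_prod (u : seq 'I_n.-1) : 'S_n :=
  (\prod_(i <- u) simple_transp i)%g.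

Lemma word_prod_tperm_lt (x y : 'I_n) : (x < y)%N ->
  exists u, word_prod u = tperm x y.
Proof.
have [d] := ubnP (y - x)%N; elim: d x => // d IHd x; rewrite ltnS => led ltxy.
have xn : (x < n.-1)%N by rewrite ltn_predRL (leq_ltn_trans ltxy).
pose i := Ordinal xn; pose x' := Ordinal (ltn_simple_r i).
have si : simple_transp i = tperm x x'.
  by rewrite /simple_transp; congr tperm; apply: val_inj.
have [eqxy | neqxy] := eqVneq x' y.
  by exists [:: i]; rewrite /word_prod big_seq1 si eqxy.
have ltx'y : (x' < y)%N by rewrite ltn_neqAle val_eqE neqxy.
have [|u uE] := IHd x' _ ltx'y.
  by apply: leq_trans led; rewrite ltn_sub2l.
exists (i :: u ++ [:: i]).
rewrite /word_prod big_cons big_cat big_seq1 /= -/(word_prod u) uE si.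
rewrite -{1}[tperm x x']tpermV -conjgE tpermJ tpermR tpermD //.
by rewrite -val_eqE neq_ltn ltxy.
Qed.

Lemma word_prod_surj (w : 'S_n) : exists u, word_prod u = w.
Proof.
have [ts -> _] := prod_tpermP w.
elim: ts => [|[x y] ts [u uE]]; first by exists [::]; rewrite /word_prod !big_nil.
rewrite big_cons /= -uE.
suff [v <-] : exists v, word_prod v = tperm x y.
  by exists (v ++ u); rewrite /word_prod big_cat.
have [ltxy | ltyx | /val_inj ->] := ltngtP x y; first exact: word_prod_tperm_lt.
  by rewrite tpermC; apply: word_prod_tperm_lt.
by exists [::]; rewrite tperm1 /word_prod big_nil.
Qed.

Lemma word_length_ex (w : 'S_n) :
  exists k, [exists u : k.-tuple 'I_n.-1, word_prod u == w].
Proof.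
have [u uE] := word_prod_surj w.
by exists (size u); apply/existsP; exists (in_tuple u); apply/eqP.
Qed.

Definition cox_length (w : 'S_n) : nat := ex_minn (word_length_ex w).

Lemma reduced_word_ex (w : 'S_n) :
  exists u : (cox_length w).-tuple 'I_n.-1, word_prod u == w.
Proof. by rewrite /cox_length; case: ex_minnP => k /existsP. Qed.

Definition reduced_word (w : 'S_n) : (cox_length w).-tuple 'I_n.-1 :=
  xchoose (reduced_word_ex w).

End Coxeter.

(* The two-sided ideal of A generated by S. *)
Inductive ideal_gen (A : nzRingType) (S : A -> Prop) : A -> Prop :=
| ideal_gen0 : ideal_gen S 0
| ideal_genD a r b x : S r -> ideal_gen S x -> ideal_gen S (a * r * b + x).

Section AlgebraQuotient.
Variables (K : fieldType) (A : algType K) (S : A -> Prop).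

Lemma ideal_gen_add x y : ideal_gen S x -> ideal_gen S y -> ideal_gen S (x + y).
Proof.
elim=> [|a r b z Sr _ IHz] Sy; first by rewrite add0r.
by rewrite -addrA; apply: ideal_genD Sr (IHz Sy).
Qed.

Lemma ideal_gen_mul c d x : ideal_gen S x -> ideal_gen S (c * x * d).
Proof.
elim=> [|a r b z Sr _ IHz]; first by rewrite mulr0 mul0r; constructor.
have ->: c * (a * r * b + z) * d = c * a * r * (b * d) + c * z * d.
  by rewrite mulrDr mulrDl !mulrA.
exact: ideal_genD.
Qed.

Lemma ideal_gen_sub x y : ideal_gen S x -> ideal_gen S y -> ideal_gen S (x - y).
Proof.
move=> Sx Sy; apply: ideal_gen_add => //.
by rewrite -mulN1r -[- 1 * y]mulr1; apply: ideal_gen_mul.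
Qed.

Definition ideal_pred : {pred A} := fun x => `[< ideal_gen S x >].

Fact ideal_pred_zmod_closed : zmod_closed ideal_pred.
Proof.
split=> [|x y /asboolP Ix /asboolP Iy]; apply/asboolP; first by constructor.
exact: ideal_gen_sub.
Qed.

HB.instance Definition _ :=
  GRing.isZmodClosed.Build A ideal_pred ideal_pred_zmod_closed.

Lemma ideal_predMl a x : x \in ideal_pred -> a * x \in ideal_pred.
Proof.
by move=> /asboolP Ix; apply/asboolP; rewrite -[a * x]mulr1; apply: ideal_gen_mul.
Qed.

Lemma ideal_predMr b x : x \in ideal_pred -> x * b \in ideal_pred.
Proof.
by move=> /asboolP Ix; apply/asboolP; rewrite -[x]mul1r; apply: ideal_gen_mul.
Qed.

Lemma ideal_predZ c x : x \in ideal_pred -> c *: x \in ideal_pred.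
Proof. by rewrite -[c *: x]mulr_algl; apply: ideal_predMl. Qed.

Local Open Scope quotient_scope.

(* MathComp algebras are nonzero, whence the argument on 1. *)
Definition alg_quot (nz : 1 \notin ideal_pred) : Type :=
  Quotient.quot ideal_pred.

Variable nz : 1 \notin ideal_pred.
Local Notation Q := (alg_quot nz).

HB.instance Definition _ := Choice.on Q.
HB.instance Definition _ := EqQuotient.on Q.
HB.instance Definition _ := GRing.Zmodule.on Q.

Lemma alg_quotP x y : reflect (\pi_Q x = \pi_Q y) (x - y \in ideal_pred).
Proof. by rewrite Quotient.idealrBE; apply: eqP. Qed.

Lemma repr_pi_sub x : repr (\pi_Q x) - x \in ideal_pred.
Proof. by apply/alg_quotP; rewrite reprK. Qed.

Definition alg_quot_mul : Q -> Q -> Q := lift_op2 Q *%R.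
Definition alg_quot_scale (c : K) : Q -> Q := lift_op1 Q ( *:%R c).

Lemma alg_quot_piD x y : \pi_Q x + \pi_Q y = \pi_Q (x + y).
Proof. by rewrite !piE. Qed.

Lemma alg_quot_piM x y : alg_quot_mul (\pi_Q x) (\pi_Q y) = \pi_Q (x * y).
Proof.
unlock alg_quot_mul; apply/alg_quotP; set x' := repr _; set y' := repr _.
have -> : x' * y' - x * y = (x' - x) * y' + x * (y' - y).
  by rewrite mulrBl mulrBr addrA subrK.
apply: rpredD; first exact: ideal_predMr (repr_pi_sub x).
exact: ideal_predMl (repr_pi_sub y).
Qed.

Lemma alg_quot_piZ c x : alg_quot_scale c (\pi_Q x) = \pi_Q (c *: x).
Proof.
unlock alg_quot_scale; apply/alg_quotP; rewrite -scalerBr.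
exact: ideal_predZ (repr_pi_sub x).
Qed.

Let alg_quot_piE := (alg_quot_piD, alg_quot_piM, alg_quot_piZ).

Fact alg_quot_mulA : associative alg_quot_mul.
Proof.
elim/quotW=> x; elim/quotW=> y; elim/quotW=> z.
by rewrite !alg_quot_piE mulrA.
Qed.

Fact alg_quot_mul1l : left_id (\pi_Q 1) alg_quot_mul.
Proof. by elim/quotW=> x; rewrite !alg_quot_piE mul1r. Qed.

Fact alg_quot_mul1r : right_id (\pi_Q 1) alg_quot_mul.
Proof. by elim/quotW=> x; rewrite !alg_quot_piE mulr1. Qed.

Fact alg_quot_mulDl : left_distributive alg_quot_mul +%R.
Proof.
elim/quotW=> x; elim/quotW=> y; elim/quotW=> z.
by rewrite !alg_quot_piE mulrDl.
Qed.

Fact alg_quot_mulDr : right_distributive alg_quot_mul +%R.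
Proof.
elim/quotW=> x; elim/quotW=> y; elim/quotW=> z.
by rewrite !alg_quot_piE mulrDr.
Qed.

Fact alg_quot_one_neq0 : \pi_Q 1 != 0.
Proof.
have -> : 0 = \pi_Q 0 :> Q by rewrite piE.
by apply: contra nz => /eqP/alg_quotP; rewrite subr0.
Qed.

HB.instance Definition _ := GRing.Zmodule_isNzRing.Build Q
  alg_quot_mulA alg_quot_mul1l alg_quot_mul1r alg_quot_mulDl alg_quot_mulDr
  alg_quot_one_neq0.

Fact alg_quot_scaleA a b x :
  alg_quot_scale a (alg_quot_scale b x) = alg_quot_scale (a * b) x.
Proof. by elim/quotW: x => x; rewrite !alg_quot_piE scalerA. Qed.

Fact alg_quot_scale1 : left_id 1 alg_quot_scale.
Proof. by elim/quotW=> x; rewrite !alg_quot_piE scale1r. Qed.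

Fact alg_quot_scaleDr : right_distributive alg_quot_scale +%R.
Proof.
move=> a; elim/quotW=> x; elim/quotW=> y.
by rewrite !alg_quot_piE scalerDr.
Qed.

Fact alg_quot_scaleDl x : {morph alg_quot_scale^~ x : a b / a + b}.
Proof.
by move=> a b; elim/quotW: x => x; rewrite !alg_quot_piE scalerDl.
Qed.

HB.instance Definition _ := GRing.Zmodule_isLmodule.Build K Q
  alg_quot_scaleA alg_quot_scale1 alg_quot_scaleDr alg_quot_scaleDl.

Fact alg_quot_scaleAl a x y :
  alg_quot_scale a (alg_quot_mul x y) = alg_quot_mul (alg_quot_scale a x) y.
Proof.
elim/quotW: x => x; elim/quotW: y => y.
by rewrite !alg_quot_piE scalerAl.
Qed.

HB.instance Definition _ := GRing.Lmodule_isLalgebra.Build K Q alg_quot_scaleAl.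

Fact alg_quot_scaleAr a x y :
  alg_quot_scale a (alg_quot_mul x y) = alg_quot_mul x (alg_quot_scale a y).
Proof.
elim/quotW: x => x; elim/quotW: y => y.
by rewrite !alg_quot_piE scalerAr.
Qed.

HB.instance Definition _ := GRing.Lalgebra_isAlgebra.Build K Q alg_quot_scaleAr.

End AlgebraQuotient.

(* The free associative algebra K<I>. *)
Definition free_alg (K : fieldType) (I : choiceType) : Type :=
  {malg K[{fmonom I}]}.

Section FreeAlgebra.
Variables (K : fieldType) (I : choiceType).

HB.instance Definition _ := GRing.Lalgebra.on (free_alg K I).

Fact free_alg_scaleAr (a : K) (x y : {malg K[{fmonom I}]}) :
  a *: (x * y) = x * (a *: y).
Proof.
apply/malgP => k; rewrite mcoeffZ mcoeffMl.
rewrite (mcoeffMlw _ (fsubset_refl _) (msuppZ_le a y)) big_distrr /=.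
apply: eq_bigr => k1 _; rewrite big_distrr /=.
by apply: eq_bigr => k2 _; rewrite mcoeffZ mulrnAr mulrCA.
Qed.

HB.instance Definition _ :=
  GRing.Lalgebra_isAlgebra.Build K (free_alg K I) free_alg_scaleAr.

Definition free_gen (i : I) : free_alg K I := << fmu i >> : {malg K[{fmonom I}]}.

End FreeAlgebra.

Section CharacterRelators.
Variables (K : fieldType) (q : K) (A : algType K) (f : {rmorphism A -> K}).
Hypothesis fZ : forall c x, f (c *: x) = c * f x.

Fact char_quadratic x : f x = q -> f (x ^+ 2 - ((q - 1) *: x + q%:A)) = 0.
Proof.
move=> fx; rewrite rmorphB rmorphD rmorphXn !fZ rmorph1 fx.
by rewrite mulr1 mulrBl mul1r subrK -expr2 subrr.
Qed.

Fact char_commute x y : f (x * y - y * x) = 0.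
Proof. by rewrite rmorphB !rmorphM mulrC subrr. Qed.

Fact char_braid x y : f x = q -> f y = q -> f (x * y * x - y * x * y) = 0.
Proof. by move=> fx fy; rewrite rmorphB !rmorphM fx fy subrr. Qed.

End CharacterRelators.

(* H_n(q) for a parameter q in an arbitrary field K. *)
Section Hecke.
Variables (K : fieldType) (q : K) (n : nat).

Local Notation F := (free_alg K 'I_n.-1).
Local Notation t := (@free_gen K 'I_n.-1).

Inductive hecke_relator : F -> Prop :=
| hecke_relator_quadratic (i : 'I_n.-1) :
    hecke_relator (t i ^+ 2 - ((q - 1) *: t i + q%:A))
| hecke_relator_commute (i j : 'I_n.-1) : (i.+1 < j)%N || (j.+1 < i)%N ->
    hecke_relator (t i * t j - t j * t i)
| hecke_relator_braid (i j : 'I_n.-1) : j = i.+1 :> nat ->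
    hecke_relator (t i * t j * t i - t j * t i * t j).

(* The character T_i |-> q shows that the quotient is nonzero. *)
Definition index_monom (m : {fmonom 'I_n.-1}) : K := q ^+ size m.

Fact index_monomM : mmorphism index_monom.
Proof.
split=> [x y|]; last by rewrite /index_monom fm1.
by rewrite /index_monom fmM size_cat exprD.
Qed.

HB.instance Definition _ :=
  isMultiplicative.Build _ K index_monom index_monomM.

Definition index_char : F -> K := mmap idfun index_monom.

HB.instance Definition _ := GRing.RMorphism.on index_char.

Fact index_charZ c x : index_char (c *: x) = c * index_char x.
Proof. exact: mmapZ. Qed.

Fact index_char_gen i : index_char (t i) = q.
Proof.
by rewrite /index_char /free_gen mmapU /= mul1r /index_monom fmU.
Qed.

Fact index_char_ideal x : ideal_gen hecke_relator x -> index_char x = 0.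
Proof.
elim=> [|a r b z Hr _ IHz]; first by rewrite rmorph0.
rewrite rmorphD !rmorphM /= IHz addr0.
suff -> : index_char r = 0 by rewrite mulr0 mul0r.
case: Hr => [i|i j _|i j _].
- exact: (char_quadratic index_charZ (index_char_gen i)).
- exact: char_commute.
- exact: (char_braid (index_char_gen i) (index_char_gen j)).
Qed.

Fact hecke_nontrivial : 1 \notin ideal_pred hecke_relator.
Proof.
apply/negP => /asboolP/index_char_ideal/eqP.
by rewrite rmorph1 oner_eq0.
Qed.

Definition hecke : algType K := alg_quot hecke_nontrivial.

Definition hecke_gen (i : 'I_n.-1) : hecke :=
  (\pi_(alg_quot hecke_nontrivial) (t i))%qT.

(* By Matsumoto's theorem T_w does not depend on the chosen reduced word. *)
Definition hecke_T (w : 'S_n) : hecke :=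
  \prod_(i <- reduced_word w) hecke_gen i.

Definition hecke_Y (k : nat) : hecke :=
  \sum_(w : 'S_n | cox_length w == k) hecke_T w.

End Hecke.

(* a is the matrix of L with respect to the basis b; rows and columns are
   indexed by I itself, so that no order on I is needed. *)
Definition is_matrix_of (K : fieldType) (V : lmodType K) (I : finType)
    (b : I -> V) (L : V -> V) (a : I -> I -> K) : Prop :=
  forall beta, L (b beta) = \sum_alpha a alpha beta *: b alpha.

Definition q_symmetric (K : fieldType) (q : K) (n : nat)
    (a : 'S_n -> 'S_n -> K) : Prop :=
  forall alpha beta,
    q ^+ cox_length alpha * a alpha beta = q ^+ cox_length beta * a beta alpha.

(* C(q), with C = R[i] for a model R of the real numbers. *)
Definition Cq (R : realType) : fieldType := {fraction {poly R[i]}}.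
Definition qvar (R : realType) : Cq R := tofrac 'X.

(* The group algebra of S_n is MathComp's group_ring: the element w is encoded
   as its matrix in the regular representation. *)
Section GroupAlgebra.
Variables (K : fieldType) (n : nat).

Definition sym_gring (w : 'S_n) : 'M[K]_#|[set: 'S_n]| :=
  regular_repr K [set: 'S_n] w.

Definition sym_gring_Y (k : nat) : 'M[K]_#|[set: 'S_n]| :=
  gset_mx K [set: 'S_n] [set w | cox_length w == k].

End GroupAlgebra.

(* Main.v *)
Require Import Defs.
From HB Require Import structures.
From mathcomp Require Import all_boot all_order all_fingroup all_algebra.
From mathcomp Require Import mxrepresentation generic_quotient monalg.
From mathcomp Require Import boolp reals complex zify.

(** H_n(q) acts on K^(S_n) by the usual formulas for T_i T_w. These operators
   commute with the analogous right multiplications, so an operator in their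
   algebra is determined by its value at e: this gives the defining relations
   and the independence of T_w of the reduced word, and it shows that a is the
   matrix of Y_k in this representation. With D = diag(q^l(w)) the generators
   satisfy D L_i = L_i^T D, hence D T_w = T_(w^-1)^T D, and summing over the
   elements of length k, a set stable under inversion, gives D a = a^T D. In
   the group algebra, m(w, z) = [l(w z^-1) = k]. *)

Set Implicit Arguments.
Unset Strict Implicit.
Unset Printing Implicit Defensive.

Import GRing.Theory.
Local Open Scope ring_scope.

(** * Words in simple transpositions and their lengths *)

Section CoxeterLength.
Variable n : nat.
Implicit Types (i j : 'I_n.-1) (u v : seq 'I_n.-1) (w : 'S_n) (x y : 'I_n).
Local Open Scope group_scope.
Local Notation s := (@simple_transp n).
Local Notation len := (@cox_length n).

(** Stated in natural numbers, so that later case analyses become linear arithmetic. *)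
Lemma simple_transpE i x :
  s i x = (if x == i :> nat then i.+1
           else if x == i.+1 :> nat then nat_of_ord i else x)
  :> nat.
Proof. by rewrite permE /= -!val_eqE /=; do 2?case: eqP => // _. Qed.

Lemma simple_transpK i : s i * s i = 1.
Proof. exact: tperm2. Qed.

Lemma simple_transpV i : (s i)^-1 = s i.
Proof. exact: tpermV. Qed.

(** An adjacent transposition is increasing on every pair other than the one it exchanges. *)
Lemma simple_transp_lt_flip i x y :
  (x < y)%N -> (s i y < s i x)%N -> s i = tperm x y.
Proof.
move=> ltxy; rewrite !simple_transpE => H.
rewrite /simple_transp; congr tperm; apply: val_inj => /=; move: H;
  do !case: eqP; lia.
Qed.

Lemma word_prod_cons i u : word_prod (i :: u) = s i * word_prod u.
Proof. exact: big_cons. Qed.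

Lemma word_prod_rcons u i : word_prod (rcons u i) = word_prod u * s i.
Proof. by rewrite /word_prod -cats1 big_cat big_seq1. Qed.

Lemma word_prod_rev u : word_prod (rev u) = (word_prod u)^-1.
Proof.
elim: u => [|i u IHu]; first by rewrite /word_prod !big_nil invg1.
by rewrite rev_cons word_prod_rcons IHu word_prod_cons invMg simple_transpV.
Qed.

Lemma cox_length_le u : (len (word_prod u) <= size u)%N.
Proof.
rewrite /cox_length; case: ex_minnP => k _; apply.
by apply/existsP; exists (in_tuple u); apply/eqP.
Qed.

Definition is_reduced u := size u == len (word_prod u).

Lemma word_prod_reduced w : word_prod (reduced_word w) = w.
Proof. exact/eqP/(xchooseP (reduced_word_ex w)). Qed.

Lemma reduced_word_is_reduced w : is_reduced (reduced_word w).
Proof. by rewrite /is_reduced word_prod_reduced size_tuple. Qed.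

Lemma reduced_ex w : exists2 u, is_reduced u & word_prod u = w.
Proof.
exists (reduced_word w); [exact: reduced_word_is_reduced|].
exact: word_prod_reduced.
Qed.

Lemma cox_lengthV w : len w^-1 = len w.
Proof.
have leV z : (len z^-1 <= len z)%N.
  have [u /eqP uR <-] := reduced_ex z.
  by rewrite -word_prod_rev -uR -(size_rev u) cox_length_le.
by apply/eqP; rewrite eqn_leq leV -{1}[w]invgK leV.
Qed.

Lemma cox_length1 : len 1 = 0%N.
Proof.
by apply/eqP; have := cox_length_le [::]; rewrite /word_prod big_nil leqn0.
Qed.

Lemma cox_length_mul_simple_le i w : (len (s i * w) <= (len w).+1)%N.
Proof.
have [u /eqP uR <-] := reduced_ex w.
by rewrite -word_prod_cons -uR cox_length_le.
Qed.

(* The images of x and y cross at some letter of u, which can be deleted. *)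
Lemma word_exchange u x y : (x < y)%N -> (word_prod u y < word_prod u x)%N ->
  exists2 v, (size v < size u)%N & word_prod v = tperm x y * word_prod u.
Proof.
elim: u x y => [|i u IHu] x y ltxy.
  by rewrite /word_prod big_nil !perm1 ltnNge ltnW.
rewrite word_prod_cons !permM => ltu.
have [ltsyx | ] := ltnP (s i y) (s i x).
  exists u; rewrite // mulgA -(simple_transp_lt_flip ltxy ltsyx).
  by rewrite simple_transpK mul1g.
rewrite leq_eqVlt => /predU1P[/val_inj/perm_inj eqxy | ltsxy].
  by rewrite eqxy ltnn in ltxy.
have [v vsz vE] := IHu _ _ ltsxy ltu.
exists (i :: v); rewrite // !word_prod_cons vE !mulgA; congr (_ * _).
by rewrite -tpermJ conjgE simple_transpV !mulgA simple_transpK mul1g.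
Qed.

(** * Ascents, and how a simple transposition changes the length *)

Definition left_index i : 'I_n := Ordinal (ltn_simple_l i).
Definition right_index i : 'I_n := Ordinal (ltn_simple_r i).

Lemma simple_transp_l i : s i (left_index i) = right_index i.
Proof. exact: tpermL. Qed.

Lemma simple_transp_r i : s i (right_index i) = left_index i.
Proof. exact: tpermR. Qed.

(** An ascent of the one-line notation: products compose left to right, so [s i * w] swaps the
    values of [w] at two adjacent positions. [left_ascentE] gives the meaning in terms of length. *)
Definition left_ascent i w := (w (left_index i) < w (right_index i))%N.

Lemma left_descentE i w :
  ~~ left_ascent i w = (w (right_index i) < w (left_index i))%N.
Proof.
rewrite /left_ascent -leqNgt leq_eqVlt.
case: eqP => [/val_inj/perm_inj/(congr1 val)/= /eqP|_ //].
by rewrite eqn_leq ltnn.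
Qed.

Lemma left_ascentM i w : left_ascent i (s i * w) = ~~ left_ascent i w.
Proof.
by rewrite left_descentE /left_ascent !permM simple_transp_l simple_transp_r.
Qed.

(** A descent is an inversion at adjacent positions, whose transposition is [s i] itself, so the
    exchange property yields a shorter word for [s i * w]. *)
Lemma cox_length_descent i w : ~~ left_ascent i w -> (len (s i * w) < len w)%N.
Proof.
rewrite left_descentE; have [u /eqP uR <-] := reduced_ex w => ltw.
have [|v vsz vE] := word_exchange _ ltw; first exact: ltnSn.
by rewrite -vE -uR (leq_ltn_trans (cox_length_le v)).
Qed.

Lemma cox_length_ascent i w : left_ascent i w -> len (s i * w) = (len w).+1.
Proof.
move=> asc; apply/eqP; rewrite eqn_leq cox_length_mul_simple_le /=.
(* For the lower bound, [s i * w] has a descent at [i], and multiplying by [s i] leads back down to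
   [w]. *)
rewrite -{1}[w]mul1g -(simple_transpK i) -mulgA cox_length_descent //.
by rewrite left_ascentM negbK.
Qed.

Lemma left_ascentE i w : left_ascent i w = (len w < len (s i * w))%N.
Proof.
apply/idP/idP => [/cox_length_ascent -> //|]; apply: contraTT.
by move/cox_length_descent/ltnW; rewrite -leqNgt.
Qed.

(** Defined through the inverse, which has the same length, so that right-hand facts follow from
    left-hand ones. *)
Definition right_ascent j w := left_ascent j w^-1.

Lemma mul_simpleV w j : (w * s j)^-1 = s j * w^-1.
Proof. by rewrite invMg simple_transpV. Qed.

Lemma right_ascentE j w : right_ascent j w = (len w < len (w * s j))%N.
Proof.
by rewrite /right_ascent left_ascentE -mul_simpleV !cox_lengthV.
Qed.

(* Right multiplication by [s j] exchanges two adjacent values, so it can only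
   reverse the order of the values of [w] at two places when it exchanges
   exactly these. *)
Lemma left_ascent_mulr_imp i j w : s i * w != w * s j ->
  left_ascent i w -> left_ascent i (w * s j).
Proof.
move=> neq asc; apply: contraNT neq.
rewrite left_descentE !permM => /(simple_transp_lt_flip asc) ->.
by rewrite -tpermJ conjgE !mulgA mulgV mul1g.
Qed.

(** The converse is the previous implication applied to [w * s j]. *)
Lemma left_ascent_mulr i j w : s i * w != w * s j ->
  left_ascent i (w * s j) = left_ascent i w.
Proof.
move=> neq; apply/idP/idP; last exact: left_ascent_mulr_imp.
move/(@left_ascent_mulr_imp i j); rewrite -mulgA simple_transpK mulg1; apply.
by apply: contra neq => /eqP e;
  rewrite -[in X in X == _]e !mulgA simple_transpK mul1g.
Qed.

Lemma right_ascent_mull i j w : s i * w != w * s j ->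
  right_ascent j (s i * w) = right_ascent j w.
Proof.
move=> neq; rewrite /right_ascent invMg simple_transpV left_ascent_mulr //.
by apply: contra neq => /eqP/(congr1 invg);
  rewrite !invMg !simple_transpV invgK => ->.
Qed.

Lemma right_ascentM j w : right_ascent j (w * s j) = ~~ right_ascent j w.
Proof. by rewrite /right_ascent mul_simpleV left_ascentM. Qed.

Lemma left_right_ascent i j w : s i * w = w * s j ->
  left_ascent i w = right_ascent j w.
Proof. by rewrite left_ascentE right_ascentE => ->. Qed.

(** At an ascent, size and length both grow by one; at a descent, the length falls below the size of
    [u], so the longer word is not reduced. *)
Lemma is_reduced_cons i u :
  is_reduced (i :: u) = is_reduced u && left_ascent i (word_prod u).
Proof.
rewrite /is_reduced word_prod_cons /=.
have [asc | /cox_length_descent lt] := boolP (left_ascent _ _).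
  by rewrite cox_length_ascent // andbT eqSS.
by rewrite andbF; have := cox_length_le u; apply/contraTF => /eqP; lia.
Qed.

Lemma is_reduced_rev u : is_reduced (rev u) = is_reduced u.
Proof. by rewrite /is_reduced size_rev word_prod_rev cox_lengthV. Qed.

Lemma is_reduced_rcons u j :
  is_reduced (rcons u j) = is_reduced u && right_ascent j (word_prod u).
Proof.
rewrite -is_reduced_rev rev_rcons is_reduced_cons is_reduced_rev.
by rewrite word_prod_rev.
Qed.

Lemma is_reduced_nil : is_reduced [::].
Proof. by rewrite /is_reduced /word_prod big_nil cox_length1. Qed.

Lemma is_reduced_seq2 i j : i != j -> is_reduced [:: i; j].
Proof.
rewrite -val_eqE /= => neq; rewrite !is_reduced_cons is_reduced_nil /=.
rewrite word_prod_cons /word_prod big_nil mulg1 /left_ascent !perm1.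
rewrite !simple_transpE /=; move/eqP: neq.
by do !case: eqP; lia.
Qed.

(** With [is_reduced_seq2], this makes both sides of the braid and commutation relations reduced
    words, to which [hecke_word_eq] applies. *)
Lemma is_reduced_braid i j : (i.+1 == j) || (j.+1 == i) ->
  is_reduced [:: i; j; i].
Proof.
move=> /orP adj; rewrite is_reduced_cons is_reduced_seq2 /=; last first.
  by rewrite -val_eqE /=; case: adj => /eqP; lia.
rewrite !word_prod_cons /word_prod big_nil mulg1 /left_ascent !permM.
rewrite !simple_transpE /=; case: adj => /eqP adj; by do !case: eqP; lia.
Qed.

Lemma simple_transp_commute i j : (i.+1 < j)%N || (j.+1 < i)%N ->
  word_prod [:: i; j] = word_prod [:: j; i].
Proof.
move=> far; rewrite !word_prod_cons /word_prod big_nil !mulg1.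
apply/permP => x; apply: val_inj; rewrite /= !permM !simple_transpE.
by do !case: eqP; lia.
Qed.

Lemma simple_transp_braid i j : j = i.+1 :> nat ->
  word_prod [:: i; j; i] = word_prod [:: j; i; j].
Proof.
move=> adj; rewrite !word_prod_cons /word_prod big_nil !mulg1.
apply/permP => x; apply: val_inj; rewrite /= !permM !simple_transpE.
by do !case: eqP; lia.
Qed.

End CoxeterLength.

(** * Universal property of the free algebra *)

Section FreeAlgebraLift.
Variables (K : fieldType) (I : choiceType) (A : algType K) (g : I -> A).

Definition word_eval (m : {fmonom I}) : A := \prod_(i <- (m : seq I)) g i.

Fact word_eval_mmorphism : mmorphism word_eval.
Proof.
split=> [x y|]; last by rewrite /word_eval fm1 big_nil.
by rewrite /word_eval fmM big_cat.
Qed.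

HB.instance Definition _ :=
  isMultiplicative.Build _ A word_eval word_eval_mmorphism.

Definition free_alg_lift : free_alg K I -> A := mmap (in_alg A) word_eval.

Fact free_alg_lift_zmod_morphism : zmod_morphism free_alg_lift.
Proof. exact: mmapB. Qed.

HB.instance Definition _ := GRing.isZmodMorphism.Build (free_alg K I) A
  free_alg_lift free_alg_lift_zmod_morphism.

(** [A] may be noncommutative: it suffices that coefficients are sent to scalars, which commute with
    the values of monomials. *)
Fact free_alg_lift_multiplicative : multiplicative free_alg_lift.
Proof.
apply: commr_mmap_is_multiplicative => x m m'.
by rewrite /GRing.comm /= mulr_algl mulr_algr.
Qed.

Fact free_alg_lift_monoid_morphism : monoid_morphism free_alg_lift.
Proof. by case: free_alg_lift_multiplicative. Qed.

HB.instance Definition _ := GRing.isMonoidMorphism.Build (free_alg K I) A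
  free_alg_lift free_alg_lift_monoid_morphism.

Fact free_alg_lift_scalable : scalable free_alg_lift.
Proof. by move=> c x; rewrite /free_alg_lift mmapZ /= mulr_algl. Qed.

HB.instance Definition _ := GRing.isScalable.Build K (free_alg K I) A *:%R
  free_alg_lift free_alg_lift_scalable.

Lemma free_alg_lift_gen i : free_alg_lift (@free_gen K I i) = g i.
Proof.
rewrite /free_alg_lift /free_gen mmapU /= scale1r mul1r.
by rewrite /word_eval fmU big_seq1.
Qed.

End FreeAlgebraLift.

(** * Universal property of the Hecke algebra *)

Section RelatorImages.
Variables (K : fieldType) (q : K) (B A : algType K) (f : {lrmorphism B -> A}).

Lemma quadratic_relator_image x y :
  f x = y -> y ^+ 2 = (q - 1) *: y + q%:A ->
  f (x ^+ 2 - ((q - 1) *: x + q%:A)) = 0.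
Proof.
move=> fx yE; rewrite rmorphB rmorphD rmorphXn /= !linearZ /= rmorph1.
by rewrite fx yE subrr.
Qed.

Lemma commute_relator_image x1 x2 y1 y2 :
  f x1 = y1 -> f x2 = y2 -> y1 * y2 = y2 * y1 -> f (x1 * x2 - x2 * x1) = 0.
Proof. by move=> fx1 fx2 yE; rewrite rmorphB !rmorphM /= fx1 fx2 yE subrr. Qed.

Lemma braid_relator_image x1 x2 y1 y2 :
  f x1 = y1 -> f x2 = y2 -> y1 * y2 * y1 = y2 * y1 * y2 ->
  f (x1 * x2 * x1 - x2 * x1 * x2) = 0.
Proof. by move=> fx1 fx2 yE; rewrite rmorphB !rmorphM /= fx1 fx2 yE subrr. Qed.

Lemma ideal_gen_image (S : B -> Prop) :
  (forall r, S r -> f r = 0) -> forall x, ideal_gen S x -> f x = 0.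
Proof.
move=> fS x; elim=> [|a r b z Sr _ IHz]; first exact: raddf0.
by rewrite rmorphD !rmorphM /= IHz (fS r) // mulr0 mul0r addr0.
Qed.

End RelatorImages.

Section HeckeLift.
Variables (K : fieldType) (q : K) (n : nat) (A : algType K).
Variable g : 'I_n.-1 -> A.
Hypothesis g_quadratic : forall i, g i ^+ 2 = (q - 1) *: g i + q%:A.
Hypothesis g_commute : forall i j : 'I_n.-1,
  (i.+1 < j)%N || (j.+1 < i)%N -> g i * g j = g j * g i.
Hypothesis g_braid : forall i j : 'I_n.-1,
  j = i.+1 :> nat -> g i * g j * g i = g j * g i * g j.

Local Notation H := (hecke q n).
Local Notation lift := (free_alg_lift g).

Lemma free_alg_lift_ideal x : ideal_gen (@hecke_relator K q n) x -> lift x = 0.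
Proof.
move: x; apply: ideal_gen_image => _ [i|i j far|i j adj].
- exact: (quadratic_relator_image (free_alg_lift_gen g i) (g_quadratic i)).
- exact: (commute_relator_image (free_alg_lift_gen g i) (free_alg_lift_gen g j)
    (g_commute far)).
- exact: (braid_relator_image (free_alg_lift_gen g i) (free_alg_lift_gen g j)
    (g_braid adj)).
Qed.

(** Computed on a chosen representative; [hecke_lift_pi] shows that any other gives the same value,
    since the two differ by an element of the ideal. *)
Definition hecke_lift (x : H) : A := lift (repr x).

Local Notation pi := (\pi_(alg_quot (@hecke_nontrivial K q n)))%qT.

Lemma hecke_lift_pi x : hecke_lift (pi x) = lift x.
Proof.
apply/eqP; rewrite -subr_eq0 -rmorphB; apply/eqP/free_alg_lift_ideal.
exact/asboolP/repr_pi_sub.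
Qed.

Lemma hecke_lift_linear c x y :
  hecke_lift (c *: x + y) = c *: hecke_lift x + hecke_lift y.
Proof.
elim/quotW: x => x; elim/quotW: y => y.
have -> : c *: (pi x : H) + pi y = pi (c *: x + y).
  by rewrite -alg_quot_piD -alg_quot_piZ.
by rewrite !hecke_lift_pi linearP.
Qed.

Lemma hecke_liftM x y : hecke_lift (x * y) = hecke_lift x * hecke_lift y.
Proof.
elim/quotW: x => x; elim/quotW: y => y.
have -> : (pi x : H) * pi y = pi (x * y) by rewrite -alg_quot_piM.
by rewrite !hecke_lift_pi rmorphM.
Qed.

Lemma hecke_lift1 : hecke_lift 1 = 1.
Proof. exact: etrans (hecke_lift_pi 1) (rmorph1 lift). Qed.

Lemma hecke_lift_gen i : hecke_lift (hecke_gen q i) = g i.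
Proof. by rewrite hecke_lift_pi free_alg_lift_gen. Qed.

HB.instance Definition _ := GRing.isLinear.Build K H A *:%R hecke_lift
  hecke_lift_linear.
HB.instance Definition _ := GRing.isMonoidMorphism.Build H A hecke_lift
  (conj hecke_lift1 hecke_liftM).

Definition hecke_lrmorphism : {lrmorphism H -> A} := hecke_lift.

Lemma hecke_lrmorphism_T w :
  hecke_lrmorphism (hecke_T q w) = \prod_(i <- reduced_word w) g i.
Proof.
by rewrite rmorph_prod; apply: eq_bigr => i _; apply: hecke_lift_gen.
Qed.

End HeckeLift.

(** * Matrices indexed by permutations *)

Section PermMatrices.
Variables (K : fieldType) (n : nat).

(* [#|'S_n|] in the form [m.+1] under which square matrices form a nonzero
   ring. *)
Definition sym_dim : nat := #|{: 'S_n}|.-1.+1.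

Lemma sym_dimE : #|{: 'S_n}| = sym_dim.
Proof. by rewrite /sym_dim prednK //; apply/card_gt0P; exists 1%g. Qed.

Definition sym_rank (w : 'S_n) : 'I_sym_dim := cast_ord sym_dimE (enum_rank w).
Definition sym_val (a : 'I_sym_dim) : 'S_n :=
  enum_val (cast_ord (esym sym_dimE) a).

Lemma sym_rankK : cancel sym_rank sym_val.
Proof. by move=> w; rewrite /sym_val /sym_rank cast_ordK enum_rankK. Qed.

Lemma sym_valK : cancel sym_val sym_rank.
Proof. by move=> a; rewrite /sym_rank /sym_val enum_valK cast_ordKV. Qed.

Definition bvec (w : 'S_n) : 'cV[K]_sym_dim := delta_mx (sym_rank w) 0.

Definition mx_of_action (f : 'S_n -> 'cV[K]_sym_dim) : 'M[K]_sym_dim :=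
  \matrix_(a, b) f (sym_val b) a 0.

Lemma mul_bvecE (A : 'M[K]_sym_dim) w a : (A *m bvec w) a 0 = A a (sym_rank w).
Proof. by rewrite -colE mxE. Qed.

Lemma mx_of_actionE f w : mx_of_action f *m bvec w = f w.
Proof. by apply/colP => a; rewrite mul_bvecE mxE sym_rankK. Qed.

Lemma bvecE w z : bvec w (sym_rank z) 0 = (z == w)%:R.
Proof. by rewrite mxE eqxx andbT (can_eq sym_rankK). Qed.

Lemma mx_bvecP (A B : 'M[K]_sym_dim) :
  (forall w, A *m bvec w = B *m bvec w) -> A = B.
Proof.
by move=> AB; apply/matrixP => a b; rewrite -[b]sym_valK -!mul_bvecE AB.
Qed.

End PermMatrices.

(** * The regular representation of the Hecke algebra *)

Section RegularRepresentation.
Variables (K : fieldType) (q : K) (n : nat).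
Local Notation s := (@simple_transp n).
Local Notation M := 'M[K]_(sym_dim n).
Local Notation bv := (@bvec K n).
Implicit Types (w : 'S_n) (i j : 'I_n.-1) (u : seq 'I_n.-1).

(** Left multiplication by $T_i$ on the standard basis. At a descent, $T_w = T_i T_{s_i w}$, and the
    quadratic relation for $T_i$ gives the second branch. *)
Definition hecke_left i : M := mx_of_action (fun w =>
  if left_ascent i w then bv (s i * w)%g
  else (q - 1) *: bv w + q *: bv (s i * w)%g).

Definition hecke_right j : M := mx_of_action (fun w =>
  if right_ascent j w then bv (w * s j)%g
  else (q - 1) *: bv w + q *: bv (w * s j)%g).

Lemma hecke_left_bvec i w : hecke_left i *m bv w =
  if left_ascent i w then bv (s i * w)%g
  else (q - 1) *: bv w + q *: bv (s i * w)%g.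
Proof. exact: mx_of_actionE. Qed.

Lemma hecke_right_bvec j w : hecke_right j *m bv w =
  if right_ascent j w then bv (w * s j)%g
  else (q - 1) *: bv w + q *: bv (w * s j)%g.
Proof. exact: mx_of_actionE. Qed.

Lemma hecke_left_quadratic i :
  hecke_left i ^+ 2 = (q - 1) *: hecke_left i + q%:A.
Proof.
apply: mx_bvecP => w; rewrite expr2 -mulmxA mulmxDl -!scalemxAl mul1mx.
rewrite !hecke_left_bvec.
by case: ifP => asc; rewrite ?mulmxDr -?scalemxAr !hecke_left_bvec;
  rewrite left_ascentM asc /= mulgA simple_transpK mul1g.
Qed.

(** If [s i * w = w * s j], both operators act in the same way on [bv w] and on [bv (s i * w)], and
    preserve their span. Otherwise multiplication on one side does not affect ascents on the other,
    and the two orders of application agree term by term. *)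
Lemma hecke_left_right i j :
  hecke_left i *m hecke_right j = hecke_right j *m hecke_left i.
Proof.
apply: mx_bvecP => w; rewrite -!mulmxA hecke_left_bvec hecke_right_bvec.
have [e | neq] := eqVneq (s i * w)%g (w * s j)%g.
  have lr := left_right_ascent e.
  have La : left_ascent i (w * s j)%g = ~~ right_ascent j w.
    by rewrite -e left_ascentM lr.
  have Ra : right_ascent j (s i * w)%g = ~~ right_ascent j w.
    by rewrite e right_ascentM.
  have sws : (s i * (w * s j))%g = w by rewrite -e mulgA simple_transpK mul1g.
  have sws' : (s i * w * s j)%g = w by rewrite -mulgA.
  rewrite lr; case: ifP => asc.
    by rewrite hecke_left_bvec hecke_right_bvec La Ra asc sws sws' e.
  rewrite !mulmxDr -!scalemxAr !hecke_left_bvec !hecke_right_bvec.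
  by rewrite La Ra lr asc sws sws' e.
have La := left_ascent_mulr neq; have Ra := right_ascent_mull neq.
case: ifP => R; case: ifP => L.
- by rewrite hecke_left_bvec hecke_right_bvec La Ra L R mulgA.
- rewrite mulmxDr -!scalemxAr hecke_left_bvec !hecke_right_bvec La Ra L R.
  by rewrite mulgA.
- rewrite mulmxDr -!scalemxAr hecke_right_bvec !hecke_left_bvec La Ra L R.
  by rewrite mulgA.
rewrite !mulmxDr -!scalemxAr !hecke_right_bvec !hecke_left_bvec La Ra L R.
(* With descents on both sides there are four terms, and the two mixed ones occur in opposite
   order. *)
rewrite !scalerDr !addrA mulgA !scalerA [q * _]mulrC -!addrA.
by congr (_ + _); rewrite addrCA.
Qed.

Definition hecke_word u : M := \prod_(i <- u) hecke_left i.

Lemma hecke_word_cons i u : hecke_word (i :: u) = hecke_left i *m hecke_word u.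
Proof. exact: big_cons. Qed.

Lemma hecke_word_rcons u i :
  hecke_word (rcons u i) = hecke_word u *m hecke_left i.
Proof. by rewrite /hecke_word -cats1 big_cat big_seq1. Qed.

Lemma hecke_word_right u j :
  hecke_word u *m hecke_right j = hecke_right j *m hecke_word u.
Proof.
elim: u => [|i u IHu]; first by rewrite /hecke_word big_nil mulmx1 mul1mx.
by rewrite hecke_word_cons -mulmxA IHu mulmxA hecke_left_right -mulmxA.
Qed.

(** Each letter of a reduced word acts at an ascent, so the quadratic branch never occurs. *)
Lemma hecke_word_bvec1 u : is_reduced u ->
  hecke_word u *m bv 1%g = bv (word_prod u).
Proof.
elim: u => [|i u IHu]; first by rewrite /hecke_word /word_prod !big_nil mul1mx.
rewrite is_reduced_cons hecke_word_cons word_prod_cons -mulmxA.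
move=> /andP[/IHu -> asc].
by rewrite hecke_left_bvec asc.
Qed.

(* [bv 1] generates the regular representation under right multiplication. *)
Lemma commute_right_inj (A B : M) :
    (forall j, A *m hecke_right j = hecke_right j *m A) ->
    (forall j, B *m hecke_right j = hecke_right j *m B) ->
  A *m bv 1%g = B *m bv 1%g -> A = B.
Proof.
move=> Ar Br AB; apply: mx_bvecP => w; have [u uR <-] := reduced_ex w.
elim/last_ind: u uR => [|u j IHu]; first by rewrite /word_prod big_nil.
rewrite is_reduced_rcons word_prod_rcons => /andP[/IHu uAB asc].
have -> : bv (word_prod u * s j)%g = hecke_right j *m bv (word_prod u).
  by rewrite hecke_right_bvec asc.
by rewrite !mulmxA Ar Br -!mulmxA uAB.
Qed.

(** Matsumoto's theorem for the operators, without braid moves: both products commute with right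
    multiplications and agree at [bv 1]. The commutation and braid relations below are special
    cases. *)
Lemma hecke_word_eq u v :
  is_reduced u -> is_reduced v -> word_prod u = word_prod v ->
  hecke_word u = hecke_word v.
Proof.
move=> uR vR uv; apply: commute_right_inj; try exact: hecke_word_right.
by rewrite !hecke_word_bvec1 // uv.
Qed.

Lemma hecke_left_commute i j : (i.+1 < j)%N || (j.+1 < i)%N ->
  hecke_left i * hecke_left j = hecke_left j * hecke_left i.
Proof.
move=> far; have neq : i != j.
  by case/orP: far; apply: contraTneq => ->; rewrite ltnNge leqnSn.
have := @hecke_word_eq [:: i; j] [:: j; i].
rewrite is_reduced_seq2 // is_reduced_seq2 1?eq_sym //.
move/(_ isT isT (simple_transp_commute far)).
by rewrite /hecke_word !big_cons big_nil !mulr1.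
Qed.

Lemma hecke_left_braid i j : j = i.+1 :> nat ->
  hecke_left i * hecke_left j * hecke_left i =
  hecke_left j * hecke_left i * hecke_left j.
Proof.
move=> adj; have := @hecke_word_eq [:: i; j; i] [:: j; i; j].
rewrite !is_reduced_braid ?adj ?eqxx ?orbT //.
move/(_ isT isT (simple_transp_braid adj)).
by rewrite /hecke_word !big_cons big_nil !mulr1 !mulrA.
Qed.

Definition hecke_basis_mx w : M := hecke_word (reduced_word w).

Lemma hecke_basis_mx_bvec1 w : hecke_basis_mx w *m bv 1%g = bv w.
Proof.
by rewrite hecke_word_bvec1 ?reduced_word_is_reduced // word_prod_reduced.
Qed.

(** * Symmetry with respect to the diagonal matrix of powers of [q] *)

Definition qlen_mx : M := diag_mx (\row_a q ^+ cox_length (sym_val a)).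

Lemma qlen_mx_mulE (A : M) w z : (qlen_mx *m A) (sym_rank w) (sym_rank z) =
  q ^+ cox_length w * A (sym_rank w) (sym_rank z).
Proof. by rewrite mul_diag_mx !mxE sym_rankK. Qed.

Lemma mul_qlen_mxE (A : M) w z : (A *m qlen_mx) (sym_rank w) (sym_rank z) =
  A (sym_rank w) (sym_rank z) * q ^+ cox_length z.
Proof. by rewrite mul_mx_diag !mxE sym_rankK. Qed.

Lemma hecke_leftE i w z : hecke_left i (sym_rank w) (sym_rank z) =
  (w == s i * z)%g%:R * (if left_ascent i z then 1 else q) +
  (w == z)%:R * (if left_ascent i z then 0 else q - 1).
Proof.
rewrite -mul_bvecE hecke_left_bvec; case: ifP => _.
  by rewrite bvecE mulr1 mulr0 addr0.
by rewrite !mxE !eqxx !andbT !(can_eq (@sym_rankK n)) addrC ![_ * _%:R]mulrC.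
Qed.

(** Off the diagonal, only [z] and [s i * z] are linked, with entry 1 upwards and [q] downwards;
    this ratio makes up for their lengths differing by one. *)
Lemma qlen_hecke_left i : qlen_mx *m hecke_left i = (hecke_left i)^T *m qlen_mx.
Proof.
apply/matrixP => a b; rewrite -[a]sym_valK -[b]sym_valK.
move: (sym_val a) (sym_val b) => w z.
rewrite qlen_mx_mulE mul_qlen_mxE [_^T _ _]mxE !hecke_leftE mulrDr mulrDl.
congr (_ + _); last first.
  by rewrite eq_sym; case: eqP => [->|_]; rewrite ?mul0r ?mulr0 // mulrC.
have -> : (z == s i * w)%g = (w == s i * z)%g.
  by apply/eqP/eqP => ->; rewrite mulgA simple_transpK mul1g.
case: eqP => [->|_]; last by rewrite !mul0r mulr0.
rewrite !mul1r left_ascentM; case: ifP => asc /=.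
  by rewrite mulr1 cox_length_ascent // exprS.
(* At a descent of [z], the shorter element is [s i * z], from which [z] is reached by an ascent. *)
rewrite mul1r -exprSr -(@cox_length_ascent _ i) ?left_ascentM ?asc //.
by rewrite mulgA simple_transpK mul1g.
Qed.

(** Transposition reverses products, hence the reversed word. *)
Lemma qlen_hecke_word u :
  qlen_mx *m hecke_word u = (hecke_word (rev u))^T *m qlen_mx.
Proof.
elim: u => [|i u IHu]; first by
  rewrite /hecke_word !big_nil trmx1 mul1mx mulmx1.
rewrite rev_cons hecke_word_rcons trmx_mul hecke_word_cons.
by rewrite mulmxA qlen_hecke_left -!mulmxA IHu.
Qed.

(** The reverse of the chosen word for [w] is reduced for [w^-1] but may differ from the word chosen
    there; [hecke_word_eq] identifies the two products. *)
Lemma qlen_hecke_basis_mx w :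
  qlen_mx *m hecke_basis_mx w = (hecke_basis_mx w^-1%g)^T *m qlen_mx.
Proof.
rewrite qlen_hecke_word; congr (_^T *m _); apply: hecke_word_eq.
- by rewrite is_reduced_rev reduced_word_is_reduced.
- exact: reduced_word_is_reduced.
by rewrite word_prod_rev !word_prod_reduced.
Qed.

Definition hecke_Y_mx k : M :=
  \sum_(w : 'S_n | cox_length w == k) hecke_basis_mx w.

Lemma qlen_hecke_Y_mx k : qlen_mx *m hecke_Y_mx k = (hecke_Y_mx k)^T *m qlen_mx.
Proof.
rewrite mulmx_sumr raddf_sum mulmx_suml [RHS](reindex_inj invg_inj) /=.
apply: eq_big => [w | w _]; first by rewrite cox_lengthV.
exact: qlen_hecke_basis_mx.
Qed.

Lemma hecke_Y_mx_sym k w z :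
  q ^+ cox_length w * hecke_Y_mx k (sym_rank w) (sym_rank z) =
  q ^+ cox_length z * hecke_Y_mx k (sym_rank z) (sym_rank w).
Proof.
by rewrite -qlen_mx_mulE qlen_hecke_Y_mx mul_qlen_mxE mxE mulrC.
Qed.

Definition hecke_regular : {lrmorphism hecke q n -> M} :=
  hecke_lrmorphism hecke_left_quadratic hecke_left_commute hecke_left_braid.

Lemma hecke_regular_T w : hecke_regular (hecke_T q w) = hecke_basis_mx w.
Proof. exact: hecke_lrmorphism_T. Qed.

Lemma hecke_regular_Y k : hecke_regular (hecke_Y q n k) = hecke_Y_mx k.
Proof.
by rewrite linear_sum; apply: eq_bigr => w _; apply: hecke_regular_T.
Qed.

(** The image of $T_x$ sends [bv 1] to [bv x], so applying the representation to the expansion of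
    $Y_k T_z$ and evaluating at [bv 1] turns the coefficients into coordinates. In particular [a] is
    unique. *)
Lemma hecke_left_mul_matrix k (a : 'S_n -> 'S_n -> K) :
  is_matrix_of (@hecke_T K q n) (fun x => hecke_Y q n k * x) a ->
  forall w z, a w z = hecke_Y_mx k (sym_rank w) (sym_rank z).
Proof.
move=> aE w z.
have := congr1 (fun x => (hecke_regular x *m bv 1%g) (sym_rank w) 0) (aE z).
rewrite rmorphM /= hecke_regular_Y hecke_regular_T -mulmxA hecke_basis_mx_bvec1.
rewrite mul_bvecE => ->; rewrite (linear_sum hecke_regular) mulmx_suml summxE.
have evZ x : (hecke_regular (a x z *: hecke_T q x) *m bv 1%g) (sym_rank w) 0 =
    a x z * (w == x)%:R.
  rewrite linearZ /= hecke_regular_T -scalemxAl hecke_basis_mx_bvec1 mxE.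
  by rewrite bvecE.
rewrite (eq_bigr (fun x => a x z * (w == x)%:R)) => [|x _]; last exact: evZ.
rewrite (bigD1 w) //= eqxx mulr1 big1 ?addr0 // => x neq.
by rewrite eq_sym (negbTE neq) mulr0.
Qed.

End RegularRepresentation.

(** * Left multiplication in the group algebra *)

Section GroupAlgebraMatrix.
Variables (K : fieldType) (n : nat).

Lemma sym_gring_Y_matrix k (m : 'S_n -> 'S_n -> K) :
  is_matrix_of (@sym_gring K n) (fun x => sym_gring_Y K n k *m x) m ->
  forall w z, m w z = (cox_length (w * z^-1)%g == k)%:R.
Proof.
move=> mE w z.
(* [gring_proj] gives the coefficient of [w] as a 1 by 1 matrix, whose only entry is taken. *)
pose proj A := @gring_proj K _ [set: 'S_n]%G w A 0 0.
have projE x : proj (sym_gring K x) = (w == x)%:R.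
  rewrite /proj gring_projE ?in_setT //.
  by case: (w == x); rewrite ?mulr1n ?mulr0n mxE.
have projZ c x : proj (c *: sym_gring K x) = c * (w == x)%:R.
  by rewrite -projE /proj linearZ mxE.
have proj_sum P F :
    proj (\sum_(x | P x) F x) = \sum_(x : 'S_n | P x) proj (F x).
  by rewrite /proj linear_sum summxE.
have YE : sym_gring_Y K n k = \sum_(x : 'S_n | cox_length x == k) sym_gring K x.
  by apply: eq_bigl => x; rewrite inE.
have := congr1 proj (mE z); rewrite YE mulmx_suml !proj_sum => eqYm.
transitivity (\sum_(x : 'S_n) m x z * (w == x)%:R).
  rewrite (bigD1 w) //= eqxx mulr1 big1 ?addr0 // => x neq.
  by rewrite eq_sym (negbTE neq) mulr0.
rewrite -(eq_bigr _ (fun x _ => projZ (m x z) x)) -eqYm.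
transitivity (\sum_(x : 'S_n | cox_length x == k) (x == w * z^-1)%g%:R : K).
  apply: eq_bigr => x _.
  rewrite /sym_gring -repr_mxM ?in_setT // projE; congr (nat_of_bool _)%:R.
  by apply/eqP/eqP => ->; rewrite ?mulgK ?mulgKV.
(* The only possible nonzero term is at [w * z^-1], which lies in the range of summation exactly
   when its length is [k]. *)
case: (boolP (_ == k)) => len_k.
  by rewrite (bigD1 _ len_k) /= eqxx big1 ?addr0 // => x /andP[_ /negbTE ->].
by rewrite big1 // => x; have [->|//] := eqVneq x; rewrite (negbTE len_k).
Qed.

End GroupAlgebraMatrix.

Theorem theorem4p6 (R : realType) (n i : nat)
    (hn : (2 <= n)%N) (hi : (1 <= i <= 'C(n, 2))%N) :
  (forall a : 'S_n -> 'S_n -> Cq R,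
     is_matrix_of (@hecke_T (Cq R) (qvar R) n)
       (fun x => hecke_Y (qvar R) n i * x) a ->
     q_symmetric (qvar R) a)
  /\
  (forall m : 'S_n -> 'S_n -> R[i],
     is_matrix_of (@sym_gring R[i] n) (fun x => sym_gring_Y R[i] n i *m x) m ->
     forall alpha beta, m alpha beta = m beta alpha).
Proof.
split=> [a aE alpha beta | m mE alpha beta].
  by rewrite !(hecke_left_mul_matrix aE) hecke_Y_mx_sym.
(* Exchanging [alpha] and [beta] inverts [alpha * beta^-1], which preserves its length. *)
rewrite !(sym_gring_Y_matrix mE) -cox_lengthV; congr (nat_of_bool (_ == _))%:R.
by rewrite invMg invgK.
Qed.
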